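(* Let $S$ be the curve $y(x+2y)(y^2+x)(y^2-x)=0$. Its local braid monodromy at $(0,0)$ is: the four points $y=1,-1,i,-i$ of the fiber over $x=1$ do a $180^\circ$ counterclockwise rotation around the center, and the two points in the center ($y=0$ and $y=-\frac12$) do a counterclockwise full-twist. That is, it is the braid induced by the motion in which first $1,-1,i,-i$ are rotated about $0$ by the angle $\pi$ counterclockwise with $0,-\frac12$ fixed, and then $-\frac12$ makes one full counterclockwise revolution around $0$ along the circle $|y|=\frac12$ with the other points fixed.
   Context: Let $E=\{x\in\mathbb{C}:|x|\le 1\}$, $D=\{y\in\mathbb{C}:|y|\le 4\}$, and regard $S$ as a curve in $E\times D$. The projection of $S$ to $E$ has fibers of constant cardinality $n=6$ except over $x=0$. Let $K\subset D$ be the set of $y$-coordinates of the points of $S$ over $x=1$, and let $u_0=-4i$. A motion of $K$ in $D$ consists of $n$ continuous functions $m_i:[0,1]\to D$ with $m_i(t)\ne m_j(t)$ for all $t$ and $i\neq j$, and $\{m_i(0)\}=\{m_i(1)\}=K$. It is realized by a continuous family of diffeomorphisms $D_t$ of $D$, $D_0=\mathrm{Id}$, equal to the identity on $\partial D$, with $D_t(m_i(0))=m_i(t)$; the braid induced by the motion is the class of $D_1$ in the braid group $B_n[D,K]$, the group of diffeomorphisms of $D$ preserving $K$ and equal to the identity on $\partial D$, two being identified if they induce the same automorphism of $\pi_1(D-K,u_0)$. The local braid monodromy of $S$ at $(0,0)$ is the braid induced by the motion formed by the points of $S$ over $x=e^{2\pi i t}$, $0\le t\le 1$. *)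

(* Defs.v *)
From Stdlib Require Import Reals Lra Lia.
From Stdlib Require Import FunctionalExtensionality PropExtensionality ProofIrrelevance.
From Coquelicot Require Import Coquelicot.

Open Scope R_scope.
Open Scope C_scope.

Definition unit_interval (t : R) : Prop := (0 <= t <= 1)%R.

Definition E (x : C) : Prop := (Cmod x <= 1)%R.
Definition D (y : C) : Prop := (Cmod y <= 4)%R.
Definition bdD (y : C) : Prop := Cmod y = 4%R.

Definition u0 : C := (0, -4)%R.

Definition cis (a : R) : C := (cos a, sin a).

(* For an equivalence relation [equiv], [equiv a] is the class of [a]. *)
Definition quotient {A : Type} (equiv : A -> A -> Prop) : Type :=
  {c : A -> Prop | exists a, c = equiv a}.

Definition class {A : Type} (equiv : A -> A -> Prop) (a : A) : quotient equiv :=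
  exist _ (equiv a) (ex_intro _ a eq_refl).

Lemma continuous_on_compose {T U V : UniformSpace} (A : T -> Prop) (B : U -> Prop)
    (f : T -> U) (g : U -> V) :
  continuous_on A f -> continuous_on B g -> (forall x, A x -> B (f x)) ->
  continuous_on A (fun x => g (f x)).
Proof.
intros Hf Hg HAB x Ax.
apply filterlim_comp with (within B (locally (f x))).
- intros P HP. generalize (Hf x Ax _ HP). unfold filtermap, within.
  apply filter_imp. auto.
- apply Hg; auto.
Qed.

Lemma continuous_on_all {T U : UniformSpace} (A : T -> Prop) (f : T -> U) :
  (forall x, continuous f x) -> continuous_on A f.
Proof. intros H; apply continuous_on_forall; intros x _; apply H. Qed.

Lemma continuous_on_prod {T U V : UniformSpace} (A : T -> Prop)
    (f : T -> U) (g : T -> V) :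
  continuous_on A f -> continuous_on A g ->
  continuous_on A (fun x => (f x, g x)).
Proof.
intros Hf Hg x Ax P [eps HP].
generalize (Hf x Ax _ (locally_ball (f x) eps)) (Hg x Ax _ (locally_ball (g x) eps)).
unfold filtermap, within; intros H1 H2.
generalize (filter_and _ _ H1 H2); apply filter_imp.
intros z [h1 h2] Az; apply HP; split; simpl; auto.
Qed.

Lemma continuous_on_plus {T : UniformSpace} (A : T -> Prop) (f g : T -> C) :
  continuous_on A f -> continuous_on A g -> continuous_on A (fun x => f x + g x).
Proof.
intros Hf Hg.
apply (continuous_on_compose A (fun _ => True) (fun x => (f x, g x))
         (fun p : C * C => fst p + snd p)); auto.
- apply continuous_on_prod; assumption.
- apply continuous_on_all; intros [a b].
  apply (continuous_plus (V := C_R_NormedModule) (fun p : C * C => fst p)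
           (fun p : C * C => snd p)); [apply continuous_fst | apply continuous_snd].
Qed.

Lemma continuous_on_opp {T : UniformSpace} (A : T -> Prop) (f : T -> C) :
  continuous_on A f -> continuous_on A (fun x => - f x).
Proof.
intros Hf.
apply (continuous_on_compose A (fun _ => True) f (fun z : C => - z)); auto.
apply continuous_on_all; intros a.
apply (continuous_opp (V := C_R_NormedModule) (fun z : C => z)), continuous_id.
Qed.

(* Values outside [unit_interval] are irrelevant. *)
Record loop (K : C -> Prop) : Type := mk_loop {
  loop_fun :> R -> C;
  loop_continuous : continuous_on unit_interval loop_fun;
  loop_avoid : forall t, unit_interval t -> D (loop_fun t) /\ ~ K (loop_fun t);
  loop_start : loop_fun 0 = u0;
  loop_end : loop_fun 1 = u0
}.

Definition homotopic {K : C -> Prop} (g h : loop K) : Prop :=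
  exists H : R * R -> C,
    continuous_on (fun p => unit_interval (fst p) /\ unit_interval (snd p)) H /\
    (forall s t, unit_interval s -> unit_interval t -> D (H (s, t)) /\ ~ K (H (s, t))) /\
    (forall t, unit_interval t -> H (0%R, t) = g t) /\
    (forall t, unit_interval t -> H (1%R, t) = h t) /\
    (forall s, unit_interval s -> H (s, 0%R) = u0 /\ H (s, 1%R) = u0).

Lemma homotopic_refl K (g : loop K) : homotopic g g.
Proof.
exists (fun p => g (snd p)); repeat split; simpl; auto.
- apply (continuous_on_compose _ unit_interval (fun p : R * R => snd p) g).
  + apply continuous_on_all; intros [a b]; apply continuous_snd.
  + apply loop_continuous.
  + now intros x [_ h].
- now apply loop_avoid.
- now apply loop_avoid.
- apply loop_start.
- apply loop_end.
Qed.

Lemma homotopic_sym K (g h : loop K) : homotopic g h -> homotopic h g.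
Proof.
intros (H & Hc & Ha & H0 & H1 & He).
assert (F : forall s, unit_interval s -> unit_interval (1 - s))
  by (unfold unit_interval; intros; lra).
exists (fun p => H ((1 - fst p)%R, snd p)); split; [|split; [|split; [|split]]]; simpl.
- refine (continuous_on_compose _ _ (fun p : R * R => ((1 - fst p)%R, snd p)) H _ Hc _).
  + apply continuous_on_prod; apply continuous_on_all; intros [a b].
    * apply (continuous_minus (V := R_NormedModule) (fun _ : R * R => 1%R)
               (fun p : R * R => fst p));
        [apply continuous_const | apply continuous_fst].
    * apply continuous_snd.
  + intros [a b] [h1 h2]; simpl in *; auto.
- auto.
- intros t ht; rewrite Rminus_0_r; auto.
- intros t ht; rewrite Rminus_diag; auto.
- auto.
Qed.

Lemma homotopic_trans K (g h k : loop K) :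
  homotopic g h -> homotopic h k -> homotopic g k.
Proof.
intros (H & Hc & Ha & H0 & H1 & He) (H' & Hc' & Ha' & H0' & H1' & He').
pose (a := fun s : R => Rmin (2 * s) 1).
pose (b := fun s : R => Rmax (2 * s - 1) 0).
assert (Fa : forall s, unit_interval s -> unit_interval (a s)).
{ unfold unit_interval, a; intros s hs; unfold Rmin; destruct Rle_dec; lra. }
assert (Fb : forall s, unit_interval s -> unit_interval (b s)).
{ unfold unit_interval, b; intros s hs; unfold Rmax; destruct Rle_dec; lra. }
assert (Ca : forall s : R, continuous a s).
{ intros s; apply continuity_pt_filterlim.
  apply (continuity_pt_ext (fun s => ((2 * s + 1 - Rabs (2 * s - 1)) / 2)%R)).
  - intros x; unfold a, Rmin, Rabs; destruct Rle_dec, Rcase_abs; lra.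
  - reg. }
assert (Cb : forall s : R, continuous b s).
{ intros s; apply continuity_pt_filterlim.
  apply (continuity_pt_ext (fun s => ((2 * s - 1 + Rabs (2 * s - 1)) / 2)%R)).
  - intros x; unfold b, Rmax, Rabs; destruct Rle_dec, Rcase_abs; lra.
  - reg. }
(* No case distinction is needed: one of the two homotopies is always at the
   common loop [h]. *)
pose (G := fun p : R * R => H (a (fst p), snd p) + (H' (b (fst p), snd p) + - h (snd p))).
assert (G1 : forall s t, unit_interval s -> unit_interval t ->
               (s <= 1 / 2)%R -> G (s, t) = H (a s, t)).
{ intros s t hs ht h2; unfold G; simpl.
  replace (b s) with 0%R by (unfold b, Rmax; destruct Rle_dec; lra).
  rewrite H0' by assumption; ring. }
assert (G2 : forall s t, unit_interval s -> unit_interval t ->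
               (1 / 2 < s)%R -> G (s, t) = H' (b s, t)).
{ intros s t hs ht h2; unfold G; simpl.
  replace (a s) with 1%R by (unfold a, Rmin; destruct Rle_dec; lra).
  rewrite H1 by assumption; ring. }
assert (I0 : unit_interval 0) by (unfold unit_interval; lra).
assert (I1 : unit_interval 1) by (unfold unit_interval; lra).
exists G; split; [|split; [|split; [|split]]].
- apply continuous_on_plus; [|apply continuous_on_plus; [|apply continuous_on_opp]].
  + refine (continuous_on_compose _ _ (fun p : R * R => (a (fst p), snd p)) H _ Hc _).
    * apply continuous_on_prod; apply continuous_on_all; intros [x y].
      -- apply (continuous_comp (fun p : R * R => fst p) a); [apply continuous_fst | apply Ca].
      -- apply continuous_snd.
    * intros [x y] [h1 h2]; simpl in *; auto.
  + refine (continuous_on_compose _ _ (fun p : R * R => (b (fst p), snd p)) H' _ Hc' _).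
    * apply continuous_on_prod; apply continuous_on_all; intros [x y].
      -- apply (continuous_comp (fun p : R * R => fst p) b); [apply continuous_fst | apply Cb].
      -- apply continuous_snd.
    * intros [x y] [h1 h2]; simpl in *; auto.
  + refine (continuous_on_compose _ _ (fun p : R * R => snd p) h _ (loop_continuous _ h) _).
    * apply continuous_on_all; intros [x y]; apply continuous_snd.
    * now intros [x y] [h1 h2].
- intros s t hs ht; destruct (Rle_lt_dec s (1 / 2)).
  + rewrite G1 by assumption; auto.
  + rewrite G2 by assumption; auto.
- intros t ht; rewrite G1 by (assumption || lra).
  replace (a 0%R) with 0%R by (unfold a, Rmin; destruct Rle_dec; lra); auto.
- intros t ht; rewrite G2 by (assumption || lra).
  replace (b 1%R) with 1%R by (unfold b, Rmax; destruct Rle_dec; lra); auto.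
- intros s hs; destruct (Rle_lt_dec s (1 / 2)).
  + rewrite !G1 by assumption; auto.
  + rewrite !G2 by assumption; auto.
Qed.

Definition pi1 (K : C -> Prop) : Type := quotient (@homotopic K).

Definition smooth_on (U : C -> Prop) (f : C -> C) : Prop :=
  forall (n : nat) (x y : R), U (x, y) ->
    ex_diff_n (fun a b => fst (f (a, b))) n x y /\
    ex_diff_n (fun a b => snd (f (a, b))) n x y.

(* Smoothness up to the boundary: extension to an open neighbourhood. *)
Definition smooth_D (f : C -> C) : Prop :=
  exists (U : C -> Prop) (F : C -> C),
    open U /\ (forall y, D y -> U y) /\ smooth_on U F /\
    (forall y, D y -> F y = f y).

(* Values outside [D] are irrelevant. *)
Definition diffeo_D (f : C -> C) : Prop :=
  exists g : C -> C,
    (forall y, D y -> D (f y)) /\ (forall y, D y -> D (g y)) /\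
    (forall y, D y -> g (f y) = y) /\ (forall y, D y -> f (g y) = y) /\
    smooth_D f /\ smooth_D g.

Record diffeo_DK (K : C -> Prop) : Type := mk_diffeo_DK {
  diffeo_fun :> C -> C;
  diffeo_diffeo : diffeo_D diffeo_fun;
  diffeo_bd : forall y, bdD y -> diffeo_fun y = y;
  (* [f(K) = K] for a subset [K] of [D] *)
  diffeo_K : forall y, D y -> (K (diffeo_fun y) <-> K y)
}.

Lemma smooth_D_continuous (f : C -> C) : smooth_D f -> continuous_on D f.
Proof.
intros (U & F & oU & DU & sF & eF).
apply continuous_on_ext with F; [assumption|].
apply continuous_on_forall; intros [x y] Dxy.
destruct (sF 0%nat x y (DU _ Dxy)) as [[c1 _] [c2 _]].
apply continuity_2d_pt_filterlim in c1.
apply continuity_2d_pt_filterlim in c2.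
intros P [eps HP].
generalize (c1 _ (locally_ball _ eps)) (c2 _ (locally_ball _ eps)).
unfold filtermap; intros e1 e2.
generalize (filter_and _ _ e1 e2); apply filter_imp.
intros [u v] [h1 h2]; apply HP; split; assumption.
Qed.

Lemma diffeo_in_D K (f : diffeo_DK K) y : D y -> D (f y).
Proof. now destruct (diffeo_diffeo K f) as (g & h & _); apply h. Qed.

Lemma diffeo_continuous K (f : diffeo_DK K) : continuous_on D f.
Proof.
destruct (diffeo_diffeo K f) as (g & _ & _ & _ & _ & h & _).
now apply smooth_D_continuous.
Qed.

Lemma bdD_u0 : bdD u0.
Proof.
unfold bdD, u0, Cmod; simpl.
replace (0 * (0 * 1) + -4 * (-4 * 1))%R with (4 * 4)%R by ring.
apply sqrt_square; lra.
Qed.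

Definition loop_image {K : C -> Prop} (f : diffeo_DK K) (g : loop K) : loop K.
Proof.
apply (mk_loop K (fun t => f (g t))).
- apply (continuous_on_compose unit_interval D g f).
  + apply loop_continuous.
  + apply diffeo_continuous.
  + intros t ht; apply (loop_avoid K g t ht).
- intros t ht; destruct (loop_avoid K g t ht) as [h1 h2]; split.
  + now apply diffeo_in_D.
  + now rewrite (diffeo_K K f).
- rewrite loop_start; apply diffeo_bd, bdD_u0.
- rewrite loop_end; apply diffeo_bd, bdD_u0.
Defined.

Lemma loop_image_homotopic K (f : diffeo_DK K) (g h : loop K) :
  homotopic g h -> homotopic (loop_image f g) (loop_image f h).
Proof.
intros (H & Hc & Ha & H0 & H1 & He).
exists (fun p => f (H p)); split; [|split; [|split; [|split]]]; simpl.
- refine (continuous_on_compose _ D H f Hc _ _).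
  + apply diffeo_continuous.
  + intros [s t] [hs ht]; apply (Ha s t hs ht).
- intros s t hs ht; destruct (Ha s t hs ht) as [h1 h2]; split.
  + now apply diffeo_in_D.
  + now rewrite (diffeo_K K f).
- intros t ht; now rewrite H0.
- intros t ht; now rewrite H1.
- intros s hs; destruct (He s hs) as [-> ->]; split; apply diffeo_bd, bdD_u0.
Qed.

Lemma pi1_map_class K (f : diffeo_DK K) (c : pi1 K) :
  exists d, (fun h => exists g, proj1_sig c g /\ homotopic (loop_image f g) h) = homotopic d.
Proof.
destruct c as [c [g0 ->]]; simpl; exists (loop_image f g0).
apply functional_extensionality; intros h.
apply propositional_extensionality; split.
- intros (g & h1 & h2).
  apply homotopic_trans with (loop_image f g); [|assumption].
  now apply loop_image_homotopic.
- intros h1; exists g0; split; [apply homotopic_refl | assumption].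
Qed.

(* The automorphism of the fundamental group induced by [f]; see [pi1_mapE]. *)
Definition pi1_map {K : C -> Prop} (f : diffeo_DK K) (c : pi1 K) : pi1 K :=
  exist _ _ (pi1_map_class K f c).

Lemma pi1_mapE K (f : diffeo_DK K) (g : loop K) :
  pi1_map f (class homotopic g) = class homotopic (loop_image f g).
Proof.
apply eq_sig_hprop; [intros; apply proof_irrelevance|]; simpl.
apply functional_extensionality; intros h.
apply propositional_extensionality; split.
- intros (g' & h1 & h2).
  apply homotopic_trans with (loop_image f g'); [|assumption].
  now apply loop_image_homotopic.
- intros h1; exists g; split; [apply homotopic_refl | assumption].
Qed.

Definition same_braid {K : C -> Prop} (f g : diffeo_DK K) : Prop :=
  pi1_map f = pi1_map g.

Definition braid (K : C -> Prop) : Type := quotient (@same_braid K).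

Definition motion (n : nat) (K : C -> Prop) (m : nat -> R -> C) : Prop :=
  (forall i, (i < n)%nat -> continuous_on unit_interval (m i)) /\
  (forall i t, (i < n)%nat -> unit_interval t -> D (m i t)) /\
  (forall i j t, (i < n)%nat -> (j < n)%nat -> i <> j -> unit_interval t ->
     m i t <> m j t) /\
  (forall y, K y <-> exists i, (i < n)%nat /\ m i 0%R = y) /\
  (forall y, K y <-> exists i, (i < n)%nat /\ m i 1%R = y).

Definition realizes (n : nat) (m : nat -> R -> C) (Dt : R -> C -> C) : Prop :=
  (forall t, unit_interval t -> diffeo_D (Dt t)) /\
  (forall t y, unit_interval t -> bdD y -> Dt t y = y) /\
  continuous_on (fun p : R * C => unit_interval (fst p) /\ D (snd p))
    (fun p => Dt (fst p) (snd p)) /\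
  (forall y, D y -> Dt 0%R y = y) /\
  (forall i t, (i < n)%nat -> unit_interval t -> Dt t (m i 0%R) = m i t).

Definition induces (n : nat) (K : C -> Prop) (m : nat -> R -> C) (b : braid K) : Prop :=
  motion n K m /\
  exists (Dt : R -> C -> C) (f : diffeo_DK K),
    realizes n m Dt /\ diffeo_fun K f = Dt 1%R /\ b = class same_braid f.

(* [S x] is the fibre of the curve [S] over [x]. The strands may be numbered in
   any order. *)
Definition local_braid_monodromy (n : nat) (S : C -> C -> Prop) (b : braid (S 1)) : Prop :=
  exists m : nat -> R -> C,
    (forall t, unit_interval t ->
       forall y, S (cis (2 * PI * t)) y <-> exists i, (i < n)%nat /\ m i t = y) /\
    induces n (S 1) m b.

Definition curve (x y : C) : Prop :=
  E x /\ D y /\ y * (x + 2 * y) * (y * y + x) * (y * y - x) = 0.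

(* Strands 0 to 3 start at [1, -1, i, -i] and move for [0 <= t <= 1/2]; strand 4
   rests at [0]; strand 5 starts at [-1/2] and moves for [1/2 <= t <= 1]. *)
Definition rotation_then_twist (i : nat) (t : R) : C :=
  let half_turn := cis (PI * Rmin (2 * t) 1) in
  let full_turn := cis (2 * PI * Rmax (2 * t - 1) 0) in
  match i with
  | 0%nat => half_turn * 1
  | 1%nat => half_turn * (- (1))
  | 2%nat => half_turn * Ci
  | 3%nat => half_turn * (- Ci)
  | 4%nat => 0
  | _ => full_turn * (- (1 / 2))
  end.

(* Main.v *)
From Stdlib Require Import Reals Lra Lia.
From Stdlib Require Import FunctionalExtensionality PropExtensionality ProofIrrelevance.
From Coquelicot Require Import Coquelicot.
Require Import Defs.

(** Both motions move every point of [K] on a circle about [0]: the points of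
    modulus [1] turn by an angle [a(t)], the point [-1/2] by an angle [b(t)].
    For the curve, [a(t) = PI t] and [b(t) = 2 PI t], because the fibre over
    [x = w ^ 2] consists of [w], [-w], [i w], [-i w], [0] and [- w ^ 2 / 2];
    for the rotation followed by the twist, [a] first runs from [0] to [PI], and
    then [b] from [0] to [2 PI].  In both cases the angles end at [(PI, 2 PI)].

    A rotation of each circle [|y| = r] by an angle depending smoothly on [r ^ 2]
    is a diffeomorphism, whose inverse turns by the opposite angle.  The angle of
    [swirl a b] is a polynomial in [r ^ 2] with the values [a] at [r = 1], [b] at
    [r = 1/2] and [0] at [r = 4].  The diffeomorphisms [swirl (a t) (b t)] thus
    realize each of the two motions, and both families end at the same
    diffeomorphism [swirl PI (2 * PI)] ([induces_swirl]).

    It remains to see that the braid does not depend on the realizing family, nor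
    on the numbering of the strands ([same_trace_same_braid]).  If [F] and [G]
    are families under which the image of [K] at each time is the same set, then
    the composite of [G 1], of the inverse of [G s] and of [F s] maps [D - K] to
    itself for every [s], and it deforms [G 1] (at [s = 0]) into [F 1] (at
    [s = 1]) while fixing the base point; so [F 1] and [G 1] induce the same
    automorphism of the fundamental group.  With [G] the family of swirls, whose
    inverses are explicit, the deformation is visibly continuous. *)

(** * Smoothness of trigonometric expressions *)

(** Smoothness asks for partial derivatives of all orders, so it is proved for a
    class of continuous functions that contains its own partial derivatives. *)
Inductive trig_expr : (R -> R -> R) -> Prop :=
| trig_const c : trig_expr (fun _ _ => c)
| trig_fst : trig_expr (fun u _ => u)
| trig_snd : trig_expr (fun _ v => v)
| trig_plus f g : trig_expr f -> trig_expr g -> trig_expr (fun u v => f u v + g u v)%R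
| trig_mult f g : trig_expr f -> trig_expr g -> trig_expr (fun u v => f u v * g u v)%R
| trig_cos f : trig_expr f -> trig_expr (fun u v => cos (f u v))
| trig_sin f : trig_expr f -> trig_expr (fun u v => sin (f u v)).

Lemma trig_minus f g : trig_expr f -> trig_expr g -> trig_expr (fun u v => f u v - g u v)%R.
Proof.
intros Hf Hg.
replace (fun u v => f u v - g u v)%R with (fun u v => f u v + -1 * g u v)%R
  by (apply functional_extensionality; intros u;
      apply functional_extensionality; intros v; ring).
repeat constructor; assumption.
Qed.

Lemma trig_expr_continuity f x y : trig_expr f -> continuity_2d_pt f x y.
Proof.
intros H; induction H.
- apply continuity_2d_pt_const.
- apply continuity_2d_pt_id1.
- apply continuity_2d_pt_id2.
- now apply continuity_2d_pt_plus.
- now apply continuity_2d_pt_mult.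
- apply (continuity_1d_2d_pt_comp cos); [apply continuity_cos | assumption].
- apply (continuity_1d_2d_pt_comp sin); [apply continuity_sin | assumption].
Qed.

(** Exchanging the variables lets the second partial derivative be obtained from
    the first. *)
Lemma trig_expr_swap f : trig_expr f -> trig_expr (fun u v => f v u).
Proof. intros H; induction H; now constructor. Qed.

Lemma trig_expr_derive_fst f : trig_expr f ->
  exists df, trig_expr df /\ forall u v, is_derive (fun z => f z v) u (df u v).
Proof.
intros H; induction H as [c| | |f g Hf [df [Tf Df]] Hg [dg [Tg Dg]]
  |f g Hf [df [Tf Df]] Hg [dg [Tg Dg]]|f Hf [df [Tf Df]]|f Hf [df [Tf Df]]].
- exists (fun _ _ => 0%R); split; [constructor|intros u v; apply @is_derive_const].
- exists (fun _ _ => 1%R); split; [constructor|intros u v; apply @is_derive_id].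
- exists (fun _ _ => 0%R); split; [constructor|intros u v; apply @is_derive_const].
- exists (fun u v => df u v + dg u v)%R; split; [now constructor|intros u v].
  now apply (is_derive_plus (V := R_NormedModule)).
- exists (fun u v => df u v * g u v + f u v * dg u v)%R; split.
  + repeat constructor; assumption.
  + intros u v; apply (is_derive_mult (fun z => f z v) (fun z => g z v)); auto.
    intros; apply Rmult_comm.
- exists (fun u v => df u v * (-1 * sin (f u v)))%R; split.
  + repeat constructor; assumption.
  + intros u v; replace (-1 * sin (f u v))%R with (- sin (f u v))%R by ring.
    apply (is_derive_comp cos (fun z => f z v)); [apply is_derive_cos | apply Df].
- exists (fun u v => df u v * cos (f u v))%R; split.
  + repeat constructor; assumption.
  + intros u v.
    apply (is_derive_comp sin (fun z => f z v)); [apply is_derive_sin | apply Df].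
Qed.

Lemma trig_expr_derive_snd f : trig_expr f ->
  exists df, trig_expr df /\ forall u v, is_derive (fun z => f u z) v (df u v).
Proof.
intros H.
destruct (trig_expr_derive_fst _ (trig_expr_swap f H)) as [df [Tf Df]].
exists (fun u v => df v u); split; [now apply trig_expr_swap|].
intros u v; apply (Df v u).
Qed.

Lemma trig_expr_ex_diff_n f n x y : trig_expr f -> ex_diff_n f n x y.
Proof.
revert f x y; induction n as [|n IH]; intros f x y H; simpl.
- split; [now apply trig_expr_continuity | exact I].
- destruct (trig_expr_derive_fst f H) as [f1 [T1 D1]].
  destruct (trig_expr_derive_snd f H) as [f2 [T2 D2]].
  split; [now apply trig_expr_continuity|].
  split; [eexists; apply D1|].
  split; [eexists; apply D2|].
  replace (fun u v => Derive (fun z => f z v) u) with f1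
    by (apply functional_extensionality; intros u;
        apply functional_extensionality; intros v;
        symmetry; apply is_derive_unique, D1).
  replace (fun u v => Derive (fun z => f u z) v) with f2
    by (apply functional_extensionality; intros u;
        apply functional_extensionality; intros v;
        symmetry; apply is_derive_unique, D2).
  split; now apply IH.
Qed.

Lemma trig_expr_smooth_D (f : C -> C) :
  trig_expr (fun u v => fst (f (u, v))) -> trig_expr (fun u v => snd (f (u, v))) ->
  smooth_D f.
Proof.
intros H1 H2; exists (fun _ => True), f; split; [apply open_true|].
split; [auto|]; split; [|auto].
intros n x y _; split; now apply trig_expr_ex_diff_n.
Qed.

(** * Swirls: rotating each circle about the origin *)

Definition norm2 (y : C) : R := (fst y * fst y + snd y * snd y)%R.

(** Lagrange interpolation in [s], the squared radius: [a] at [s = 1], where four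
    of the points lie, [b] at [s = 1/4], the place of [-1/2], and [0] at [s = 16],
    so that the boundary of [D] stays fixed. *)
Definition angle (a b s : R) : R :=
  (a * (4 / 45 * ((s + - (1 / 4)) * (16 + -1 * s)))
   + b * (16 / 189 * ((s + -1) * (s + -16))))%R.

Definition swirl (a b : R) (y : C) : C := (cis (angle a b (norm2 y)) * y)%C.

Lemma cis_plus a b : cis (a + b) = (cis a * cis b)%C.
Proof.
unfold cis; rewrite cos_plus, sin_plus.
apply injective_projections; simpl; ring.
Qed.

Lemma cis_0 : cis 0 = 1%C.
Proof. unfold cis; now rewrite cos_0, sin_0. Qed.

Lemma norm2_cis_mult a y : norm2 (cis a * y)%C = norm2 y.
Proof.
generalize (sin2_cos2 a); unfold norm2, cis, Rsqr; simpl; intros h.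
transitivity ((sin a * sin a + cos a * cos a)
              * (fst y * fst y + snd y * snd y))%R; [ring|rewrite h; ring].
Qed.

Lemma Cmod_norm2 y : Cmod y = sqrt (norm2 y).
Proof. unfold Cmod, norm2; f_equal; ring. Qed.

Lemma norm2_swirl a b y : norm2 (swirl a b y) = norm2 y.
Proof. apply norm2_cis_mult. Qed.

Lemma D_swirl a b y : D (swirl a b y) <-> D y.
Proof. unfold D; now rewrite !Cmod_norm2, norm2_swirl. Qed.

Lemma swirl_comp a b a' b' y :
  swirl a b (swirl a' b' y) = swirl (a + a') (b + b') y.
Proof.
unfold swirl at 1; rewrite norm2_swirl; unfold swirl.
replace (angle (a + a') (b + b') (norm2 y))
  with (angle a b (norm2 y) + angle a' b' (norm2 y))%R by (unfold angle; ring).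
rewrite cis_plus; ring.
Qed.

Lemma swirl_0 y : swirl 0 0 y = y.
Proof.
unfold swirl; replace (angle 0 0 (norm2 y)) with 0%R by (unfold angle; ring).
rewrite cis_0; ring.
Qed.

Lemma swirlK a b y : swirl (- a) (- b) (swirl a b y) = y.
Proof. rewrite swirl_comp, !Rplus_opp_l; apply swirl_0. Qed.

Lemma swirlVK a b y : swirl a b (swirl (- a) (- b) y) = y.
Proof. rewrite swirl_comp, !Rplus_opp_r; apply swirl_0. Qed.

Lemma swirl_inj a b y z : swirl a b y = swirl a b z -> y = z.
Proof. intros h; now rewrite <- (swirlK a b y), h, swirlK. Qed.

Lemma swirl_bd a b y : bdD y -> swirl a b y = y.
Proof.
unfold bdD; rewrite Cmod_norm2; intros h.
assert (norm2 y = 16)%R as e.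
{ rewrite <- (sqrt_sqrt (norm2 y)), h; [ring|unfold norm2; nra]. }
unfold swirl; rewrite e.
replace (angle a b 16) with 0%R by (unfold angle; ring).
rewrite cis_0; ring.
Qed.

Lemma smooth_D_swirl a b : smooth_D (swirl a b).
Proof.
apply trig_expr_smooth_D; unfold swirl, cis, angle, norm2; simpl.
- apply trig_minus; repeat constructor.
- repeat constructor.
Qed.

Lemma diffeo_D_swirl a b : diffeo_D (swirl a b).
Proof.
exists (swirl (- a) (- b)); repeat split; intros.
- now apply D_swirl.
- now apply D_swirl.
- apply swirlK.
- apply swirlVK.
- apply smooth_D_swirl.
- apply smooth_D_swirl.
Qed.

Lemma continuous_Rplus {T : UniformSpace} (f g : T -> R) x :
  continuous f x -> continuous g x -> continuous (fun z => f z + g z)%R x.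
Proof. apply (continuous_plus (V := R_NormedModule)). Qed.

Lemma continuous_Rmult {T : UniformSpace} (f g : T -> R) x :
  continuous f x -> continuous g x -> continuous (fun z => f z * g z)%R x.
Proof. apply (continuous_mult (K := R_AbsRing)). Qed.

Lemma continuous_pair {T U V : UniformSpace} (f : T -> U) (g : T -> V) x :
  continuous f x -> continuous g x -> continuous (fun z => (f z, g z)) x.
Proof.
intros Hf Hg P [eps HP].
generalize (Hf _ (locally_ball (f x) eps)) (Hg _ (locally_ball (g x) eps)).
unfold filtermap; intros H1 H2.
generalize (filter_and _ _ H1 H2); apply filter_imp.
intros z [h1 h2]; apply HP; now split.
Qed.

Lemma continuous_swirl (p : (R * R) * C) :
  continuous (fun p : (R * R) * C => swirl (fst (fst p)) (snd (fst p)) (snd p)) p.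
Proof.
assert (Ca : continuous (fun p : (R * R) * C => fst (fst p)) p).
{ apply (continuous_comp (fun p : (R * R) * C => fst p) (fun q : R * R => fst q));
    apply continuous_fst. }
assert (Cb : continuous (fun p : (R * R) * C => snd (fst p)) p).
{ apply (continuous_comp (fun p : (R * R) * C => fst p) (fun q : R * R => snd q));
    [apply continuous_fst | apply continuous_snd]. }
assert (Cu : continuous (fun p : (R * R) * C => fst (snd p)) p).
{ apply (continuous_comp (fun p : (R * R) * C => snd p) (fun q : R * R => fst q));
    [apply continuous_snd | apply continuous_fst]. }
assert (Cv : continuous (fun p : (R * R) * C => snd (snd p)) p).
{ apply (continuous_comp (fun p : (R * R) * C => snd p) (fun q : R * R => snd q));
    apply continuous_snd. }
assert (Ct : continuous (fun p : (R * R) * C =>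
               angle (fst (fst p)) (snd (fst p)) (norm2 (snd p))) p).
{ unfold angle, norm2.
  repeat first [ assumption | apply continuous_const
               | apply continuous_Rplus | apply continuous_Rmult ]. }
assert (Cc := continuous_comp _ cos p Ct (continuous_cos _)).
assert (Cs := continuous_comp _ sin p Ct (continuous_sin _)).
unfold swirl, Cmult, cis; simpl.
apply continuous_pair.
- apply (continuous_minus (V := R_NormedModule)); now apply continuous_Rmult.
- apply continuous_Rplus; now apply continuous_Rmult.
Qed.

Lemma continuous_on_swirl {T : UniformSpace} (A : T -> Prop) (a b : T -> R) (f : T -> C) :
  continuous_on A a -> continuous_on A b -> continuous_on A f ->
  continuous_on A (fun x => swirl (a x) (b x) (f x)).
Proof.
intros Ca Cb Cf.
apply (continuous_on_compose A (fun _ => True) (fun x => ((a x, b x), f x))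
         (fun p : (R * R) * C => swirl (fst (fst p)) (snd (fst p)) (snd p))); auto.
- now repeat apply continuous_on_prod.
- apply continuous_on_all, continuous_swirl.
Qed.

Lemma continuous_on_swirl_family (c d : R -> R) :
  continuous_on unit_interval c -> continuous_on unit_interval d ->
  continuous_on (fun q : R * C => unit_interval (fst q) /\ D (snd q))
    (fun q => swirl (c (fst q)) (d (fst q)) (snd q)).
Proof.
intros Cc Cd.
assert (Cf : continuous_on (fun q : R * C => unit_interval (fst q) /\ D (snd q))
               (fun q : R * C => fst q)).
{ apply continuous_on_all; intros q; apply continuous_fst. }
apply (continuous_on_swirl _ (fun q : R * C => c (fst q)) (fun q : R * C => d (fst q))).
- apply (continuous_on_compose _ unit_interval (fun q : R * C => fst q) c); tauto.
- apply (continuous_on_compose _ unit_interval (fun q : R * C => fst q) d); tauto.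
- apply continuous_on_all; intros q; apply continuous_snd.
Qed.

Lemma continuous_on_Ropp {T : UniformSpace} (A : T -> Prop) (f : T -> R) :
  continuous_on A f -> continuous_on A (fun x => - f x)%R.
Proof.
intros Cf; apply (continuous_on_compose A (fun _ => True) f Ropp); auto.
apply continuous_on_all; intros x.
apply (continuous_opp (V := R_NormedModule) (fun z : R => z)), continuous_id.
Qed.

(** * Independence of the braid from the realizing isotopy *)

Lemma class_eq {A : Type} (equiv : A -> A -> Prop) (x y : A) :
  (forall a b, equiv a b -> equiv b a) ->
  (forall a b c, equiv a b -> equiv b c -> equiv a c) ->
  equiv x y -> class equiv x = class equiv y.
Proof.
intros sym trans h; apply eq_sig_hprop; [intros; apply proof_irrelevance|]; simpl.
apply functional_extensionality; intros z.
apply propositional_extensionality; split; eauto.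
Qed.

Lemma same_braid_of_homotopic K (f g : diffeo_DK K) :
  (forall h : loop K, homotopic (loop_image f h) (loop_image g h)) -> same_braid f g.
Proof.
intros H; apply functional_extensionality; intros [c [h e]]; subst c.
change (pi1_map f (class homotopic h) = pi1_map g (class homotopic h)).
rewrite !pi1_mapE; apply class_eq; [apply homotopic_sym|apply homotopic_trans|apply H].
Qed.

Lemma same_braid_class K (f g : diffeo_DK K) :
  same_braid f g -> class same_braid f = class same_braid g.
Proof.
apply class_eq; unfold same_braid; [auto | intros; etransitivity; eauto].
Qed.

Lemma D_u0 : D u0.
Proof. unfold D; rewrite bdD_u0; lra. Qed.

(** [g] composed with [Ginv s] and [F s] maps [D - K] to itself; [s] running from
    [0] to [1] deforms [g] into [f] through such maps.
    The strands of the two motions are compared only as sets of points at each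
    time, so their numberings need not agree, not even continuously in [t]. *)
Lemma same_trace_same_braid n K (m p : nat -> R -> C) (F G Ginv : R -> C -> C)
    (f g : diffeo_DK K) :
  motion n K m -> motion n K p ->
  (forall i t, (i < n)%nat -> unit_interval t ->
     exists j, (j < n)%nat /\ p i t = m j t) ->
  realizes n m F -> diffeo_fun K f = F 1%R ->
  realizes n p G -> diffeo_fun K g = G 1%R ->
  continuous_on (fun q : R * C => unit_interval (fst q) /\ D (snd q))
    (fun q => Ginv (fst q) (snd q)) ->
  (forall t y, unit_interval t -> D y -> D (Ginv t y)) ->
  (forall t y, unit_interval t -> D y -> G t (Ginv t y) = y) ->
  (forall t y, unit_interval t -> D y -> Ginv t (G t y) = y) ->
  same_braid f g.
Proof.
intros (_ & Dm & _ & Km & _) (_ & Dp & _ & Kp & _) Hpm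
  (diffF & bdF & cF & F0 & mF) fF (diffG & bdG & _ & G0 & pG) gG cV DV GV VG.
assert (I0 : unit_interval 0) by (unfold unit_interval; lra).
assert (I1 : unit_interval 1) by (unfold unit_interval; lra).
assert (DF : forall t y, unit_interval t -> D y -> D (F t y)).
{ intros t y ht; destruct (diffF t ht) as (_ & h & _); auto. }
assert (injF : forall t y z, unit_interval t -> D y -> D z -> F t y = F t z -> y = z).
{ intros t y z ht Dy Dz e; destruct (diffF t ht) as (k & _ & _ & h & _).
  now rewrite <- (h y Dy), e, h. }
(* Only here does the hypothesis on the traces enter: it keeps the deformation
   away from [K]. *)
assert (KV : forall t y, unit_interval t -> D y -> K (Ginv t (F t y)) -> K y).
{ intros t y ht Dy Ky; apply Kp in Ky; destruct Ky as (i & hi & e).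
  destruct (Hpm i t hi ht) as (j & hj & ej).
  apply Km; exists j; split; [assumption|].
  apply (injF t); auto.
  rewrite mF, <- ej, <- pG, e by assumption; auto. }
apply same_braid_of_homotopic; intros h; apply homotopic_sym.
(* The parameter [0] gives [g] and the parameter [1] gives [f]. *)
exists (fun q => g (Ginv (fst q) (F (fst q) (h (snd q))))).
split; [|split; [|split; [|split]]]; simpl.
- assert (Dh : forall q : R * R, unit_interval (fst q) /\ unit_interval (snd q) ->
            unit_interval (fst q) /\ D (h (snd q))).
  { intros q [h1 h2]; split; [assumption|apply (loop_avoid K h _ h2)]. }
  assert (Cs : continuous_on
            (fun q : R * R => unit_interval (fst q) /\ unit_interval (snd q))
            (fun q : R * R => fst q)).
  { apply continuous_on_all; intros q; apply continuous_fst. }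
  assert (Ch : continuous_on
            (fun q : R * R => unit_interval (fst q) /\ unit_interval (snd q))
            (fun q : R * R => h (snd q))).
  { apply (continuous_on_compose _ unit_interval (fun q : R * R => snd q) h).
    - apply continuous_on_all; intros q; apply continuous_snd.
    - apply loop_continuous.
    - now intros q [_ h2]. }
  apply (continuous_on_compose _ D
           (fun q : R * R => Ginv (fst q) (F (fst q) (h (snd q)))) g).
  + apply (continuous_on_compose _ (fun q : R * C => unit_interval (fst q) /\ D (snd q))
             (fun q : R * R => (fst q, F (fst q) (h (snd q))))
             (fun q => Ginv (fst q) (snd q))); [|assumption|].
    * apply continuous_on_prod; [assumption|].
      apply (continuous_on_compose _ (fun q : R * C => unit_interval (fst q) /\ D (snd q))
               (fun q : R * R => (fst q, h (snd q)))
               (fun q => F (fst q) (snd q))); [|assumption|exact Dh].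
      now apply continuous_on_prod.
    * intros q hq; destruct (Dh q hq); simpl; auto.
  + apply diffeo_continuous.
  + intros q hq; destruct (Dh q hq); auto.
- intros s t hs ht; destruct (loop_avoid K h t ht) as [Dh nK]; split.
  + apply diffeo_in_D; auto.
  + rewrite (diffeo_K K g) by auto; intros k; apply nK; now apply (KV s).
- intros t ht; destruct (loop_avoid K h t ht) as [Dh _].
  now rewrite F0, <- (G0 (Ginv 0%R (h t))), GV by auto.
- intros t ht; destruct (loop_avoid K h t ht) as [Dh _].
  rewrite gG, fF; apply GV; auto.
- assert (Vu0 : forall s, unit_interval s -> g (Ginv s (F s u0)) = u0).
  { intros s hs; rewrite bdF by (auto using bdD_u0).
    rewrite <- (bdG s u0 hs bdD_u0) at 1; rewrite VG by auto using D_u0.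
    apply diffeo_bd, bdD_u0. }
  intros s hs; rewrite loop_start, loop_end; auto.
Qed.

(** * The six strands *)

Definition start (i : nat) : C :=
  (match i with
   | 0%nat => 1
   | 1%nat => - (1)
   | 2%nat => Ci
   | 3%nat => - Ci
   | 4%nat => 0
   | _ => - (1 / 2)
   end)%C.

Lemma swirl_norm2_1 a b y : norm2 y = 1%R -> swirl a b y = (cis a * y)%C.
Proof.
intros e; unfold swirl; rewrite e; do 2 f_equal; unfold angle; field.
Qed.

Lemma swirl_half a b : swirl a b (- (1 / 2))%C = (cis b * - (1 / 2))%C.
Proof.
unfold swirl; do 2 f_equal; unfold angle, norm2; simpl; field.
Qed.

Lemma swirl_start a b i :
  swirl a b (start i) =
  (match i with
   | 0%nat | 1%nat | 2%nat | 3%nat => cis a * start i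
   | 4%nat => 0
   | _ => cis b * start i
   end)%C.
Proof.
destruct i as [|[|[|[|[|i]]]]]; try (apply swirl_norm2_1; unfold norm2; simpl; ring).
- unfold swirl; simpl; ring.
- apply swirl_half.
Qed.

Lemma start_D i : D (start i).
Proof.
unfold D; rewrite Cmod_norm2; rewrite <- (sqrt_square 4) by lra.
apply sqrt_le_1_alt.
destruct i as [|[|[|[|[|i]]]]]; unfold norm2; simpl; lra.
Qed.

Lemma start_inj i j : (i < 6)%nat -> (j < 6)%nat -> start i = start j -> i = j.
Proof.
intros hi hj e.
assert (e1 : fst (start i) = fst (start j)) by now rewrite e.
assert (e2 : snd (start i) = snd (start j)) by now rewrite e.
clear e; revert e1 e2.
destruct i as [|[|[|[|[|[|i]]]]]]; try lia;
destruct j as [|[|[|[|[|[|j]]]]]]; try lia; simpl; intros; (reflexivity || lra).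
Qed.

Lemma Cmult_eq_0 (x y : C) : (x * y)%C = 0%C -> x = 0%C \/ y = 0%C.
Proof.
intros h; destruct (Ceq_dec x 0) as [->|nx]; [now left|].
destruct (Ceq_dec y 0) as [->|ny]; [now right|].
now destruct (Cmult_neq_0 x y nx ny).
Qed.

Lemma Cmod_cis a : Cmod (cis a) = 1%R.
Proof.
rewrite Cmod_norm2.
replace (norm2 (cis a)) with (norm2 (cis a * 1)%C) by (f_equal; ring).
rewrite norm2_cis_mult; unfold norm2; simpl.
replace (1 * 1 + 0 * 0)%R with 1%R by ring; apply sqrt_1.
Qed.

(** With [w = cis s] the fibre is over [w ^ 2], and the equation splits into
    linear factors. *)
Lemma curve_cis s y :
  curve (cis (2 * s)) y <->
  exists i, (i < 6)%nat /\ swirl s (2 * s) (start i) = y.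
Proof.
assert (ew : cis (2 * s) = (cis s * cis s)%C)
  by (replace (2 * s)%R with (s + s)%R by ring; apply cis_plus).
set (w := cis s) in *.
assert (factor : (y * (w * w + 2 * y) * (y * y + w * w) * (y * y - w * w))%C
  = (y * ((w * w + 2 * y) * ((y - w * Ci) * ((y + w * Ci) * ((y - w) * (y + w))))))%C).
{ clearbody w; destruct w, y; apply injective_projections; simpl; ring. }
split.
- intros (_ & _ & h); rewrite ew, factor in h.
  assert (moveD : forall u v : C, (u - v)%C = 0%C -> v = u).
  { intros u v e; replace u with (u - v + v)%C by ring; rewrite e; ring. }
  assert (moveS : forall u v : C, (u + v)%C = 0%C -> (- v)%C = u).
  { intros u v e; replace u with (u + v - v)%C by ring; rewrite e; ring. }
  repeat (apply Cmult_eq_0 in h; destruct h as [h|h]).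
  + exists 4%nat; split; [lia|]; now rewrite swirl_start.
  + exists 5%nat; split; [lia|]; rewrite swirl_start, ew; simpl.
    apply moveS in h.
    replace y with ((2 * y) * (1 / 2))%C
      by (apply injective_projections; simpl; field).
    replace (2 * y)%C with (- (w * w))%C
      by (rewrite <- h; apply injective_projections; simpl; ring).
    ring.
  + exists 2%nat; split; [lia|]; rewrite swirl_start; simpl; now apply moveD.
  + exists 3%nat; split; [lia|]; rewrite swirl_start; simpl.
    rewrite <- (moveS _ _ h); fold w; ring.
  + exists 0%nat; split; [lia|]; rewrite swirl_start; simpl.
    rewrite <- (moveD _ _ h); fold w; ring.
  + exists 1%nat; split; [lia|]; rewrite swirl_start; simpl.
    rewrite <- (moveS _ _ h); fold w; ring.
- intros (i & hi & <-); split; [|split].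
  + unfold E; rewrite Cmod_cis; lra.
  + apply D_swirl, start_D.
  + rewrite ew.
    destruct i as [|[|[|[|[|[|i]]]]]]; try lia; rewrite swirl_start; try rewrite ew;
      fold w; apply injective_projections; simpl; field.
Qed.

(* The next two descriptions of [curve 1] come from [w = 1] and [w = -1]. *)
Lemma curve_1_start y : curve 1%C y <-> exists i, (i < 6)%nat /\ start i = y.
Proof.
replace (RtoC 1) with (cis (2 * 0)) by (rewrite Rmult_0_r; apply cis_0).
rewrite curve_cis, Rmult_0_r.
split; intros (i & hi & e); exists i; rewrite swirl_0 in *; auto.
Qed.

Lemma curve_1_swirl y :
  curve 1%C y <-> exists i, (i < 6)%nat /\ swirl PI (2 * PI) (start i) = y.
Proof.
rewrite <- curve_cis; replace (cis (2 * PI)) with (RtoC 1); [reflexivity|].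
unfold cis; now rewrite cos_2PI, sin_2PI.
Qed.

Lemma swirl_preserves_curve_1 y : curve 1%C (swirl PI (2 * PI) y) <-> curve 1%C y.
Proof.
rewrite curve_1_swirl, curve_1_start; split; intros (i & hi & e); exists i; split; auto.
- now apply swirl_inj in e.
- now rewrite e.
Qed.

Definition swirl_diffeo : diffeo_DK (curve 1%C) :=
  mk_diffeo_DK (curve 1%C) (swirl PI (2 * PI)) (diffeo_D_swirl _ _) (swirl_bd _ _)
    (fun y _ => swirl_preserves_curve_1 y).

(** * The braid induced by turning the circles *)

(** A motion turning the circles [|y| = 1] and [|y| = 1/2] by the angles [a] and
    [b]; both motions of the theorem are of this kind, and only the final angles
    enter the induced braid. *)
Section Swirling.

Variables (a b : R -> R) (m : nat -> R -> C).
Hypothesis a_cont : continuous_on unit_interval a.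
Hypothesis b_cont : continuous_on unit_interval b.
Hypotheses (a_0 : a 0%R = 0%R) (b_0 : b 0%R = 0%R).
Hypotheses (a_1 : a 1%R = PI) (b_1 : b 1%R = (2 * PI)%R).
Hypothesis m_swirl : forall i t, (i < 6)%nat -> unit_interval t ->
  m i t = swirl (a t) (b t) (start i).

Lemma motion_swirl : motion 6 (curve 1%C) m.
Proof.
assert (I0 : unit_interval 0) by (unfold unit_interval; lra).
assert (I1 : unit_interval 1) by (unfold unit_interval; lra).
split; [|split; [|split; [|split]]].
- intros i hi; apply continuous_on_ext with (fun t => swirl (a t) (b t) (start i)).
  + intros t ht; symmetry; auto.
  + apply continuous_on_swirl; auto.
    apply continuous_on_all; intros t; apply continuous_const.
- intros i t hi ht; rewrite m_swirl by auto; apply D_swirl, start_D.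
- intros i j t hi hj ne ht e; apply ne, start_inj; auto.
  rewrite !m_swirl in e by auto; now apply swirl_inj in e.
- intros y; rewrite curve_1_start.
  split; intros (i & hi & e); exists i; split; auto; revert e;
    rewrite m_swirl, a_0, b_0, swirl_0; auto.
- intros y; rewrite curve_1_swirl.
  split; intros (i & hi & e); exists i; split; auto; revert e;
    rewrite m_swirl, a_1, b_1; auto.
Qed.

Lemma realizes_swirl : realizes 6 m (fun t => swirl (a t) (b t)).
Proof.
assert (I0 : unit_interval 0) by (unfold unit_interval; lra).
split; [|split; [|split; [|split]]].
- intros t _; apply diffeo_D_swirl.
- intros t y _; apply swirl_bd.
- now apply continuous_on_swirl_family.
- intros y _; rewrite a_0, b_0; apply swirl_0.
- intros i t hi ht; rewrite !m_swirl by auto; now rewrite a_0, b_0, swirl_0.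
Qed.

Lemma induces_swirl : induces 6 (curve 1%C) m (class same_braid swirl_diffeo).
Proof.
split; [apply motion_swirl|].
exists (fun t => swirl (a t) (b t)), swirl_diffeo.
split; [apply realizes_swirl|split; [|reflexivity]].
now rewrite a_1, b_1.
Qed.

Lemma induced_class_unique (p : nat -> R -> C) (c : braid (curve 1%C)) :
  (forall i t, (i < 6)%nat -> unit_interval t ->
     exists j, (j < 6)%nat /\ m i t = p j t) ->
  induces 6 (curve 1%C) p c -> c = class same_braid swirl_diffeo.
Proof.
intros trace (motp & F & f & realF & fF & ->); apply same_braid_class.
apply (same_trace_same_braid 6 _ p m F (fun t => swirl (a t) (b t))
         (fun t => swirl (- a t) (- b t))); auto.
- apply motion_swirl.
- apply realizes_swirl.
- now rewrite a_1, b_1.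
- apply (continuous_on_swirl_family (fun t => - a t)%R (fun t => - b t)%R);
    now apply continuous_on_Ropp.
- intros t y _; apply D_swirl.
- intros t y _ _; apply swirlVK.
- intros t y _ _; apply swirlK.
Qed.

End Swirling.

Lemma continuous_linear (c t : R) : continuous (fun t => c * t)%R t.
Proof.
apply continuous_Rmult; [apply continuous_const | apply continuous_id].
Qed.

(* [Rmin] and [Rmax] are written with [Rabs], whose continuity is known. *)
Lemma continuous_turn_first (c t : R) : continuous (fun t => c * Rmin (2 * t) 1)%R t.
Proof.
apply continuous_Rmult; [apply continuous_const|].
apply continuity_pt_filterlim.
apply (continuity_pt_ext (fun t => ((2 * t + 1 - Rabs (2 * t - 1)) / 2)%R)).
- intros x; unfold Rmin, Rabs; destruct Rle_dec, Rcase_abs; lra.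
- reg.
Qed.

Lemma continuous_turn_last (c t : R) : continuous (fun t => c * Rmax (2 * t - 1) 0)%R t.
Proof.
apply continuous_Rmult; [apply continuous_const|].
apply continuity_pt_filterlim.
apply (continuity_pt_ext (fun t => ((2 * t - 1 + Rabs (2 * t - 1)) / 2)%R)).
- intros x; unfold Rmax, Rabs; destruct Rle_dec, Rcase_abs; lra.
- reg.
Qed.

Lemma rotation_then_twist_swirl i t :
  rotation_then_twist i t =
  swirl (PI * Rmin (2 * t) 1) (2 * PI * Rmax (2 * t - 1) 0) (start i).
Proof. rewrite swirl_start; now destruct i as [|[|[|[|[|i]]]]]. Qed.

Theorem theorem5p11 :
  exists b : braid (curve 1),
    (forall b' : braid (curve 1), local_braid_monodromy 6 curve b' <-> b' = b) /\
    (forall b' : braid (curve 1),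
       induces 6 (curve 1) rotation_then_twist b' <-> b' = b).
Proof.
exists (class same_braid swirl_diffeo); split; intros b'.
- assert (fibre : forall t y, curve (cis (2 * PI * t)) y <->
            exists i, (i < 6)%nat /\ swirl (PI * t) (2 * PI * t) (start i) = y).
  { intros t y; rewrite Rmult_assoc; apply curve_cis. }
  split.
  + intros (p & fibre_p & ind_p).
    apply (induced_class_unique (fun t => PI * t)%R (fun t => 2 * PI * t)%R
             (fun i t => swirl (PI * t) (2 * PI * t) (start i))) with p;
      auto using continuous_on_all, continuous_linear; try ring.
    intros i t hi ht.
    destruct (proj1 (fibre_p t ht (swirl (PI * t) (2 * PI * t) (start i))))
      as (j & hj & e); [apply fibre; eauto | eauto].
  + intros ->.
    exists (fun i t => swirl (PI * t) (2 * PI * t) (start i)); split; [auto|].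
    apply (induces_swirl (fun t => PI * t)%R (fun t => 2 * PI * t)%R);
      auto using continuous_on_all, continuous_linear; ring.
- assert (a0 : (PI * Rmin (2 * 0) 1 = 0)%R) by (rewrite Rmin_left; lra).
  assert (b0 : (2 * PI * Rmax (2 * 0 - 1) 0 = 0)%R) by (rewrite Rmax_right; lra).
  assert (a1 : (PI * Rmin (2 * 1) 1 = PI)%R) by (rewrite Rmin_right; lra).
  assert (b1 : (2 * PI * Rmax (2 * 1 - 1) 0 = 2 * PI)%R) by (rewrite Rmax_left; lra).
  split.
  + apply (induced_class_unique (fun t => PI * Rmin (2 * t) 1)%R
             (fun t => 2 * PI * Rmax (2 * t - 1) 0)%R rotation_then_twist);
      auto using continuous_on_all, continuous_turn_first, continuous_turn_last,
        rotation_then_twist_swirl.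
    intros i t hi _; eauto.
  + intros ->.
    apply (induces_swirl (fun t => PI * Rmin (2 * t) 1)%R
             (fun t => 2 * PI * Rmax (2 * t - 1) 0)%R);
      auto using continuous_on_all, continuous_turn_first, continuous_turn_last,
        rotation_then_twist_swirl.
Qed.
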